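(* Let $D$ be a finite distributive lattice and let $k\geq 2$ be an integer. Then \[ \gamma(D^k)=\min\{\,n\in\mathbb{N}_0:\ k\,J(D)\ \text{order-embeds into}\ (\mathcal{P}([n]);\subseteq)\,\}, \] where $\gamma(L)$ denotes the minimum size of a generating set of a finite lattice $L$, $J(D)$ is the poset of join-irreducible elements of $D$, and $k\,J(D)$ is the cardinal sum of $k$ copies of $J(D)$.
   Context: $\mathbb{N}_0=\{0,1,2,\dots\}$; $[n]=\{1,\dots,n\}$ and $[0]=\emptyset$; $\mathcal{P}([n])$ is the powerset lattice of $[n]$ ordered by inclusion. $D^k$ is the $k$-th direct power of $D$ with componentwise operations. A subset $Y$ of a lattice $L$ is a generating set if no proper sublattice of $L$ contains $Y$; $\gamma(L)=\min\{|Y|: Y \text{ generates } L\}$. An element $x$ of a finite lattice is join-irreducible if it covers exactly one element (so $0\notin J(D)$); $J(D)$ carries the order inherited from $D$. For a poset $U$ and $k\in\mathbb{N}$, the cardinal sum $kU$ is the disjoint union of $k$ isomorphic copies of $U$, where elements in different copies are incomparable. An order embedding $\phi:U_1\to U_2$ is a map with $x\le y\iff \phi(x)\le\phi(y)$. *)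

(* Defs.v *)
From HB Require Import structures.
From mathcomp Require Import all_boot all_order.

Set Implicit Arguments.
Unset Strict Implicit.
Unset Printing Implicit Defensive.

Import Order.TTheory.
Import Order.SetSubsetOrder.Exports.
Local Open Scope order_scope.

Section Generation.
Variables (d : Order.disp_t) (L : finLatticeType d).
Implicit Types S Y : {set L}.

(* Sublattices are nonempty, so that the one-element lattice is generated by
   the empty set. *)
Definition sublattice S : bool :=
  (S != set0) &&
  [forall x in S, forall y in S, (x `&` y \in S) && (x `|` y \in S)].

Definition generating Y : bool :=
  ~~ [exists S : {set L}, [&& sublattice S, S \proper [set: L] & Y \subset S]].

Lemma generatingT : generating [set: L].
Proof.
apply/existsP => -[S /and3P[_ + sTS]].
by rewrite properE sTS andbF.
Qed.

(* By generatingT the minimum is taken over a nonempty family. *)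
Definition gamma : nat :=
  #|[arg min_(Y < [set: L] | generating Y) #|Y| ]%N|.

Lemma gammaP :
  (exists2 Y : {set L}, generating Y & #|Y| = gamma) /\
  (forall Y : {set L}, generating Y -> (gamma <= #|Y|)%N).
Proof.
rewrite /gamma; case: arg_minnP => [|Y genY minY]; first exact: generatingT.
by split=> //; exists Y.
Qed.

End Generation.

Section JoinIrreducible.
Variables (d : Order.disp_t) (D : finPOrderType d).
Implicit Types x y z : D.

Definition covers x y : bool := (y < x) && ~~ [exists z : D, y < z < x].

Definition join_irreducible x : bool := #|[set y | covers x y]| == 1%N.

Definition J : Type := {x : D | join_irreducible x}.

HB.instance Definition _ := Finite.on J.
HB.instance Definition _ := SubType.on J.
HB.instance Definition _ := [SubChoice_isSubPOrder of J by <: with d].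

End JoinIrreducible.

(* The carrier of the disjoint union of k copies of U; the first component of a
   pair is the index of the copy. *)
Definition cardinal_sum (d : Order.disp_t) (k : nat) (U : finPOrderType d) :
  Type := ('I_k * U)%type.

Section CardinalSum.
Variables (d : Order.disp_t) (k : nat) (U : finPOrderType d).
Local Notation kU := (cardinal_sum k U).

HB.instance Definition _ := Finite.on kU.

Definition cardinal_sum_le (p q : kU) : bool :=
  (p.1 == q.1) && (p.2 <= q.2).

Fact cardinal_sum_le_refl : reflexive cardinal_sum_le.
Proof. by move=> p; rewrite /cardinal_sum_le eqxx lexx. Qed.

Fact cardinal_sum_le_anti : antisymmetric cardinal_sum_le.
Proof.
move=> [i x] [j y] /andP[/andP[/= /eqP-> xy] /andP[_ yx]].
by congr pair; apply: le_anti; rewrite xy.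
Qed.

Fact cardinal_sum_le_trans : transitive cardinal_sum_le.
Proof.
move=> [j y] [i x] [l z] /andP[/= /eqP-> xy] /andP[/= /eqP-> yz].
by rewrite /cardinal_sum_le eqxx (le_trans xy yz).
Qed.

HB.instance Definition _ := Order.Le_isPOrder.Build d kU
  cardinal_sum_le_refl cardinal_sum_le_anti cardinal_sum_le_trans.

End CardinalSum.

Definition powerset_poset (n : nat) : Type := {set 'I_n}.

HB.instance Definition _ n := Finite.copy (powerset_poset n) {set 'I_n}.
HB.instance Definition _ n := Order.POrder.copy (powerset_poset n)
  (Order.SetSubsetOrder.type Order.SetSubsetOrder.subset_display 'I_n).

Lemma lePowerset n (A B : powerset_poset n) : (A <= B) = (A \subset B).
Proof. by []. Qed.

Section Embedding.
Variables (d1 : Order.disp_t) (U1 : finPOrderType d1).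

Definition order_embeds (d2 : Order.disp_t) (U2 : finPOrderType d2) : bool :=
  [exists f : {ffun U1 -> U2}, [forall x, forall y, (x <= y) == (f x <= f y)]].

Lemma order_embedsP (d2 : Order.disp_t) (U2 : finPOrderType d2) :
  reflect (exists f : U1 -> U2, forall x y, x <= y <-> f x <= f y)
          (order_embeds U2).
Proof.
apply: (iffP existsP) => -[f fE].
  by exists f => x y; rewrite (eqP (forallP (forallP fE x) y)).
exists (finfun f); apply/forallP => x; apply/forallP => y; rewrite !ffunE.
by apply/eqP; apply/idP/idP => /fE.
Qed.

Lemma ex_order_embeds_powerset : exists n, order_embeds (powerset_poset n).
Proof.
exists #|U1|; apply/order_embedsP.
exists (fun x => [set i | enum_val i <= x] : powerset_poset #|U1|) => x y.
rewrite lePowerset; split=> [xy|/subsetP/(_ (enum_rank x))].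
  by apply/subsetP => i; rewrite !inE => /le_trans; apply.
by rewrite !inE enum_rankK lexx; apply.
Qed.

Definition min_powerset_dim : nat := ex_minn ex_order_embeds_powerset.

End Embedding.

Arguments gamma {d} L.
Arguments J {d} D.
Arguments cardinal_sum {d} k U.
Arguments order_embeds {d1} U1 {d2} U2.
Arguments min_powerset_dim {d1} U1.

(* Main.v *)
Require Import Defs.
From mathcomp Require Import all_boot all_order.

(** Let [U] index a join-dense family [e] of join-prime elements of a finite
    distributive lattice [L], with [e] an order embedding. If [Y] generates [L]
    then [u |-> {y in Y : ~ e u <= y}] embeds [U] into the powerset of [Y]:
    reflection of the order holds because, for fixed [u] and [v], the [x] with
    [e v <= x -> e u <= x] form a sublattice. Conversely an embedding [f] of [U]
    into the powerset of [n] yields the [n] elements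
    [y_i = \join_(u | i \notin f u) e u], and [e v] is the meet of the [y_i] with
    [i \notin f v]; if [U] has no greatest element these meets are nonempty, and
    if [U] has no least element the bottom is a meet of elements [e u].
    For [L = D^k] take [U = k J(D)], where [e] puts a join-irreducible on one
    coordinate and [\bot] elsewhere; [k >= 2] excludes greatest and least
    elements. *)

Section Sublattices.
Import Order.TTheory.
Local Open Scope order_scope.
Variables (d : Order.disp_t) (L : finTBLatticeType d).
Implicit Types S : {set L}.

Lemma sublattice_meet S x y :
  sublattice S -> x \in S -> y \in S -> x `&` y \in S.
Proof.
by move=> /andP[_ /forall_inP clS] /clS/forall_inP/[apply]/andP[].
Qed.

Lemma sublattice_join S x y :
  sublattice S -> x \in S -> y \in S -> x `|` y \in S.
Proof.
by move=> /andP[_ /forall_inP clS] /clS/forall_inP/[apply]/andP[].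
Qed.

(** The index [i0] keeps the meet nonempty: an empty one is [\top], which a sublattice may miss. *)
Lemma sublattice_bigmeet S (I : finType) (P : pred I) (F : I -> L) i0 :
  sublattice S -> P i0 -> (forall i, P i -> F i \in S) ->
  \meet_(i | P i) F i \in S.
Proof.
move=> sublS Pi0 FS; rewrite (bigD1 i0) //=.
elim/big_rec: _ => [|i x /andP[Pi _] IHx]; first by rewrite meetx1 FS.
by rewrite meetCA sublattice_meet // FS.
Qed.

Lemma sublattice_bigjoin S (I : finType) (P : pred I) (F : I -> L) :
  sublattice S -> \bot \in S -> (forall i, P i -> F i \in S) ->
  \join_(i | P i) F i \in S.
Proof.
move=> sublS S0 FS; elim/big_rec: _ => // i x Pi xS.
by rewrite sublattice_join // FS.
Qed.

Lemma generatingP (Y : {set L}) :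
  reflect (forall S x, sublattice S -> Y \subset S -> x \in S) (generating Y).
Proof.
apply: (iffP idP) => [/existsPn genY S x sublS YS|genY].
  have /(_ S) := genY; rewrite sublS YS andbT /= properE subsetT /= negbK.
  by move/subsetP; apply.
apply/existsP => -[S /and3P[sublS /properP[_ [x _ xS]] YS]].
by move: xS; rewrite genY.
Qed.

End Sublattices.

Section JoinPrimeFamily.
Import Order.TTheory.
Local Open Scope order_scope.

Definition join_prime {d : Order.disp_t} {L : tbLatticeType d} (p : L) : Prop :=
  p <> \bot /\ forall x y, p <= x `|` y -> p <= x \/ p <= y.

(** Says that each [x] is the least upper bound of the [e u] below it, phrased without joins. *)
Definition join_dense {d : Order.disp_t} {L : porderType d} {U : Type}
    (e : U -> L) : Prop :=
  forall x y, (forall u, e u <= x -> e u <= y) -> x <= y.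

Lemma join_prime_bigjoin {d : Order.disp_t} {L : tbLatticeType d} (p : L)
    (I : finType) (P : pred I) (F : I -> L) :
  join_prime p -> p <= \join_(i | P i) F i -> exists2 i, P i & p <= F i.
Proof.
move=> [p0 pP]; elim/big_rec: _ => [|i x Pi IHx]; first by rewrite lex0 => /eqP.
by case/pP => // pFi; exists i.
Qed.

Variables (d : Order.disp_t) (L : finTBLatticeType d).
Variables (dU : Order.disp_t) (U : finPOrderType dU) (e : U -> L).
Hypothesis e_le : forall u v, (e u <= e v) = (u <= v).
Hypothesis e_prime : forall u, join_prime (e u).

Lemma generating_order_embeds (Y : {set L}) :
  generating Y -> order_embeds U (powerset_poset #|Y|).
Proof.
move=> /generatingP genY; apply/order_embedsP.
exists (fun u => [set i | ~~ (e u <= enum_val i)] : powerset_poset #|Y|).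
move=> u v; rewrite lePowerset; split=> [uv|fuv].
  apply/subsetP => i; rewrite !inE; apply: contraNN.
  by apply: le_trans; rewrite e_le.
pose S := [set x : L | (e v <= x) ==> (e u <= x)].
have sublS : sublattice S.
  apply/andP; split; first by apply/set0Pn; exists \top; rewrite inE !lex1.
  apply/forall_inP => x; rewrite inE => /implyP xS.
  apply/forall_inP => y; rewrite inE => /implyP yS.
  rewrite !inE !lexI; apply/andP; split; apply/implyP.
    by move=> /andP[/xS -> /yS ->].
  (* Closure under joins is where primality of [e v] enters. *)
  case/(e_prime v).2 => [/xS|/yS] h; first exact: le_trans h (leUl _ _).
  exact: le_trans h (leUr _ _).
suff: e v \in S by rewrite inE lexx /= e_le.
(* A generator outside [S] would have its index in the image of [u] but not in that of [v]. *)
apply: genY => //; apply/subsetP => y yY; rewrite inE; apply: contraTT isT.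
rewrite negb_imply => /andP[vy uy].
have := subsetP fuv (enum_rank_in yY y).
by rewrite !inE enum_rankK_in // uy vy => /(_ isT).
Qed.

Hypothesis e_dense : join_dense e.
Hypothesis no_greatest : forall u : U, exists v, ~~ (v <= u).
Hypothesis no_least : forall u : U, exists v, ~~ (u <= v).

Lemma order_embeds_gamma_le n :
  order_embeds U (powerset_poset n) -> (gamma L <= n)%N.
Proof.
case/order_embedsP => f fE.
pose y i := \join_(u | i \notin f u) e u.
have le_y u i : (e u <= y i) = (i \notin f u).
  (* Primality yields [v] above [u] with [i] outside [f v], hence outside [f u]. *)
  apply/idP/idP => [/join_prime_bigjoin-/(_ (e_prime u))[v iv]|iu].
    by rewrite e_le => /fE/subsetP fuv; apply: contraNN iv; apply: fuv.
  exact: joins_sup.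
have e_meet v : e v = \meet_(i | i \notin f v) y i.
  apply: le_anti; apply/andP; split; first by apply/meetsP => i; rewrite le_y.
  apply: e_dense => u /meetsP uy; rewrite e_le; apply/fE/subsetP => i.
  by apply: contraTT => /uy; rewrite le_y.
rewrite -[n in (_ <= n)%N]card_ord -cardsT.
(* [y] need not be injective, so its image has at most [n] elements. *)
apply: leq_trans (leq_imset_card y _).
apply: (gammaP L).2; apply/generatingP => S x sublS /subsetP YS.
have yS i : y i \in S by apply: YS; apply: imset_f.
have eS v : e v \in S.
  have [w wv] := no_greatest v.
  have /subsetPn[i _ iv] : ~~ (f w \subset f v) by apply: contraNN wv => /fE.
  by rewrite e_meet; apply: (@sublattice_bigmeet _ _ _ _ _ _ i).
have S0 : \bot \in S.
  (* If [U] is empty, density puts every element below [\bot], and [S] is nonempty by definition. *)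
  have [u0 _|U0] := pickP U; last first.
    have [/set0Pn[z zS] _] := andP sublS.
    suff <- : z = \bot by [].
    by apply/eqP; rewrite -lex0; apply: e_dense => u; have := U0 u.
  suff <- : \meet_u e u = \bot by apply: sublattice_bigmeet u0 _ _ _.
  apply/eqP; rewrite -lex0; apply: e_dense => u /meetsP ue.
  by have [v /negP[]] := no_least u; rewrite -e_le ue.
suff -> : x = \join_(u | e u <= x) e u by apply: sublattice_bigjoin.
apply: le_anti; apply/andP; split; last exact/joinsP.
by apply: e_dense => u ux; apply: joins_sup.
Qed.

Lemma gamma_eq_min_powerset_dim : gamma L = min_powerset_dim U.
Proof.
rewrite /min_powerset_dim; case: ex_minnP => n embn min_n; apply/eqP.
rewrite eqn_leq order_embeds_gamma_le //=.
have [[Y genY <-] _] := gammaP L.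
exact/min_n/generating_order_embeds.
Qed.

End JoinPrimeFamily.

Section JoinIrreducibles.
Import Order.TTheory.
Local Open Scope order_scope.
Variables (d : Order.disp_t) (D : finTBDistrLatticeType d).
Implicit Types x y z p : D.

(** The size of the down-set is strictly monotone, so an element maximizing it among those with
    [y <= z < x] is a lower cover of [x]. *)
Lemma lt_covers x y : y < x -> exists2 z, covers x z & y <= z.
Proof.
move=> yx; pose h z := #|[set w | w <= z]|.
have Py : y <= y < x by rewrite lexx.
case: (@arg_maxnP _ y (fun z => y <= z < x) h Py) => z /andP[yz zx] max_z.
exists z => //; rewrite /covers zx; apply/existsP => -[w /andP[zw wx]].
have := max_z w; rewrite (le_trans yz (ltW zw)) wx => /(_ isT).
apply/negP; rewrite -ltnNge; apply: proper_card; apply/properP; split.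
  by apply/subsetP => t; rewrite !inE => /le_trans; apply; apply: ltW.
by exists w; rewrite inE ?lexx // lt_geF.
Qed.

(** If [p] is below neither [x] nor [y], its meets with both lie below its only lower cover; by
    distributivity so does [p], which is absurd. *)
Lemma join_irreducible_prime p : join_irreducible p -> join_prime p.
Proof.
move=> /cards1P[c cE].
have le_c z : z < p -> z <= c.
  move=> /lt_covers[w wp /le_trans]; apply.
  suff: w \in [set c] by rewrite inE => /eqP ->.
  by rewrite -cE inE.
have /andP[cp _] : covers p c by have := set11 c; rewrite -cE inE.
split=> [p0|x y pxy]; first by move: cp; rewrite p0 ltx0.
have [px|npx] := boolP (p <= x); first by left.
have [py|npy] := boolP (p <= y); first by right.
have below z : ~~ (p <= z) -> p `&` z <= c.
  move=> npz; apply: le_c; rewrite lt_neqAle leIl andbT.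
  by apply: contraNN npz => /eqP <-; apply: leIr.
suff /(lt_le_trans cp) : p <= c by rewrite ltxx.
by rewrite -(meet_idPl pxy) meetUr leUx !below.
Qed.

(** Induction on the number of elements strictly below [x]: if [x] is neither [\bot] nor
    join-irreducible, it is the join of two lower covers. *)
Lemma join_irreducible_dense : join_dense (fun p : J D => val p : D).
Proof.
move=> x y; have [m] := ubnP #|[set w | w < x]|.
elim: m x => // m IHm x; rewrite ltnS => le_m xy.
have IH z : z < x -> z <= y.
  move=> zx; apply: IHm => [|u uz]; last by apply/xy/(le_trans uz)/ltW.
  apply: leq_trans le_m; apply: proper_card; apply/properP; split.
    by apply/subsetP => t; rewrite !inE => /lt_trans; apply.
  by exists z; rewrite !inE ?ltxx.
have [xJ|] := boolP (join_irreducible x); first exact: (xy (Sub x xJ)).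
have [->|x0] := eqVneq x \bot; first by rewrite le0x.
have /lt_covers[c cx _] : \bot < x by rewrite lt0x.
rewrite /join_irreducible => card_neq1.
have [c' c'x neq_c] : exists2 c', covers x c' & c' != c.
  have : [set z | covers x z] != [set c].
    by apply: contraNneq card_neq1 => ->; rewrite cards1.
  rewrite eqEsubset sub1set inE cx andbT => /subsetPn[c'].
  by rewrite !inE; exists c'.
have [/andP[ltcx ncx] /andP[ltc'x nc'x]] := (cx, c'x).
suff -> : x = c `|` c' by rewrite leUx !IH.
apply/eqP; rewrite eq_sym eq_le leUx (ltW ltcx) (ltW ltc'x) /=.
(* A join strictly below [x] would have to equal [c'], and then [c < c' < x] contradicts that [x]
   covers [c]. *)
apply: contraT => nxU; case/negP: nc'x; apply/existsP; exists (c `|` c').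
have ltUx : c `|` c' < x by rewrite lt_leAnge leUx (ltW ltcx) (ltW ltc'x).
rewrite ltUx andbT lt_neqAle leUr andbT; apply: contraNneq ncx => c'E.
apply/existsP; exists c'; rewrite ltc'x andbT lt_neqAle eq_sym neq_c.
by rewrite c'E leUl.
Qed.

End JoinIrreducibles.

Section Power.
Import Order.TTheory.
Local Open Scope order_scope.
Variables (d : Order.disp_t) (D : finTBDistrLatticeType d) (k : nat).

Definition power_single (i : 'I_k) (x : D) : k.-tupleprod D :=
  [tuple (if j == i then x else \bot) | j < k].

(** [power_single i] is left adjoint to the [i]-th projection, which reduces order questions in the
    power to one coordinate. *)
Lemma power_single_le i x (t : k.-tupleprod D) :
  (power_single i x <= t) = (x <= tnth t i).
Proof.
rewrite leEtprod; apply/forallP/idP => [/(_ i)|xt j]; rewrite tnth_mktuple.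
  by rewrite eqxx.
by case: eqP => [->|]; rewrite ?le0x.
Qed.

Definition power_irreducible (u : cardinal_sum k (J D)) : k.-tupleprod D :=
  power_single u.1 (val u.2).

Lemma power_irreducible_le u v :
  (power_irreducible u <= power_irreducible v) = (u <= v).
Proof.
rewrite power_single_le tnth_mktuple.
rewrite [RHS]/(cardinal_sum_le u v) /cardinal_sum_le.
(* For different copies the comparison reads [val u.2 <= \bot], impossible for a join-prime
   element. *)
case: eqP => //= _; rewrite lex0.
by have [/eqP/negPf ->] := join_irreducible_prime _ _ _ (valP u.2).
Qed.

Lemma power_irreducible_prime u : join_prime (power_irreducible u).
Proof.
have [u0 uP] := join_irreducible_prime _ _ _ (valP u.2).
split=> [|x y]; last by rewrite !power_single_le tnth_join => /uP.
move/eqP; rewrite -lex0 power_single_le botEtprod tnth_mktuple lex0.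
by move/eqP.
Qed.

Lemma power_irreducible_dense : join_dense power_irreducible.
Proof.
move=> x y xy; rewrite leEtprod; apply/forallP => i.
apply: join_irreducible_dense => p px.
by have := xy (i, p); rewrite !power_single_le; apply.
Qed.

End Power.

Theorem theorem2p4 (d : Order.disp_t) (D : finTBDistrLatticeType d) (k : nat)
    (hk : 2 <= k) :
  gamma (k.-tupleprod D) = min_powerset_dim (cardinal_sum k (J D)).
Proof.
have other (i : 'I_k) : exists j : 'I_k, j != i.
  apply/existsP; rewrite -[X in is_true X]negbK; apply/existsPn => eq_i.
  have : #|'I_k| <= #|[set i]|.
    by apply/subset_leq_card/subsetP => j _; rewrite inE -[_ == _]negbK eq_i.
  by rewrite card_ord cards1 leqNgt hk.
apply: (@gamma_eq_min_powerset_dim _ _ _ _ (@power_irreducible d D k)).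
- exact: power_irreducible_le.
- exact: power_irreducible_prime.
- exact: power_irreducible_dense.
(* The same [p] in another copy is incomparable to [(i, p)], so no element is greatest or least. *)
- case=> i p; have [j ij] := other i; exists (j, p).
  by rewrite [(_ <= _)%O]/(cardinal_sum_le _ _) /cardinal_sum_le (negPf ij).
- case=> i p; have [j ij] := other i; exists (j, p).
  by rewrite [(_ <= _)%O]/(cardinal_sum_le _ _) /cardinal_sum_le eq_sym (negPf ij).
Qed.
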